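(* Let $H$ be a hypergraph in which every edge contains at least $k$ vertices and meets at most $d$ other edges. Let $t\geqslant 2$ and $s\geqslant 1$ be two integers with $k\geqslant st$. If $$ e\sum_{j=0}^{s-1}\binom{k}{j}\left(\frac{1}{t}\right)^{j}\left(1-\frac{1}{t}\right)^{k-j}\Big((d+1)(t-1)+1\Big)\leqslant 1, $$ then $H$ has a $(t,s)$-coloring.
   Context: A hypergraph $H$ consists of a collection $\mathcal{E}$ of subsets of a finite set $V$; the members of $V$ are the vertices and the members of $\mathcal{E}$ are the edges of $H$. Here $k$ and $d$ are nonnegative integers. Two edges $f,g$ meet if $f\cap g\neq\emptyset$. For integers $t\geqslant 2$ and $s\geqslant 1$, a $(t,s)$-coloring of $H$ is a coloring of its vertices using $t$ colors (i.e. a map $V\to\{1,\ldots,t\}$) such that each color appears on each edge at least $s$ times, i.e. every edge contains at least $s$ vertices of each of the $t$ colors. The symbol $e$ denotes the base of the natural logarithm. In the displayed inequality, the left-hand side is the product of $e$, the sum $\sum_{j=0}^{s-1}\binom{k}{j}(1/t)^{j}(1-1/t)^{k-j}$, and the factor $(d+1)(t-1)+1$. *)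

(* Defs.v *)
From mathcomp Require Import all_boot.
Set Implicit Arguments.
Unset Strict Implicit.
Unset Printing Implicit Defensive.

Definition hypergraph (V : finType) := {set {set V}}.

Definition meets (V : finType) (f g : {set V}) : bool := f :&: g != set0.

Definition met_edges (V : finType) (H : hypergraph V) (f : {set V}) :
    {set {set V}} :=
  [set g in H | (g != f) && meets f g].

Definition ts_coloring (V : finType) (H : hypergraph V) (t s : nat)
    (c : V -> 'I_t) : Prop :=
  forall (f : {set V}) (i : 'I_t), f \in H -> s <= #|[set v in f | c v == i]|.

(* Main.v *)
(** The lopsided local lemma, applied to a uniformly random coloring. Fix [k]
    vertices in each edge [f], and let the bad event [(f, i)] be that color [i]
    appears fewer than [s] times among them; it has probability
    [p = P(Bin(k, 1/t) < s)]. Giving more vertices the color [i] makes [(f, i)]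
    less likely and never creates a bad event [(g, i)], so bad events of the same
    color are positively correlated. Hence [(f, i)] need only be linked to the
    [(g, j)] with [j <> i] and [g] equal to [f] or meeting it, that is to at most
    [(d + 1)(t - 1)] others, and [e p ((d + 1)(t - 1) + 1) <= 1] suffices. *)
Require Import Defs.
From mathcomp Require Import all_boot all_order all_algebra.
From mathcomp Require Import reals sequences exp.
From mathcomp Require Import ring lra.
Set Implicit Arguments.
Unset Strict Implicit.
Unset Printing Implicit Defensive.
Import Order.TTheory GRing.Theory Num.Theory.
Local Open Scope ring_scope.

Definition avoiding (Omega I : finType) (A : I -> {set Omega}) (S : {set I}) :
    {set Omega} :=
  [set w | [forall j in S, w \notin A j]].

Lemma avoidingP (Omega I : finType) (A : I -> {set Omega}) (S : {set I}) w :
  reflect (forall j, j \in S -> w \notin A j) (w \in avoiding A S).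
Proof. by rewrite inE; apply: (iffP forall_inP). Qed.

Lemma avoidingS (Omega I : finType) (A : I -> {set Omega}) (S T : {set I}) :
  S \subset T -> avoiding A T \subset avoiding A S.
Proof.
move=> sST; apply/subsetP => w /avoidingP aT; apply/avoidingP => j jS.
by apply: aT; apply: (subsetP sST).
Qed.

Lemma avoidingU1 (Omega I : finType) (A : I -> {set Omega}) (S : {set I}) j :
  avoiding A (j |: S) = avoiding A S :\: A j.
Proof.
apply/setP => w; rewrite in_setD; apply/avoidingP/andP => [aw|[wj /avoidingP aw]].
  by split; [apply: aw; rewrite setU11|
             apply/avoidingP => l lS; apply: aw; rewrite setU1r].
by move=> l; rewrite in_setU1 => /orP[/eqP->|/aw].
Qed.

(* Adding the elements of [T] to [S] one at a time loses at most a fraction [x]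
   of the remaining outcomes at each step. *)
Lemma avoiding_card_ge (R : realFieldType) (Omega I : finType)
    (A : I -> {set Omega}) (x : R) (S T : {set I}) :
  0 <= x <= 1 ->
  (forall (U : {set I}) i, (#|U| < #|S :|: T|)%N ->
     #|A i :&: avoiding A U|%:R <= x * #|avoiding A U|%:R) ->
  (1 - x) ^+ #|T| * #|avoiding A S|%:R <= #|avoiding A (S :|: T)|%:R.
Proof.
move=> /andP[x0 x1]; have [m] := ubnP #|T|; elim: m T => // m IHm T ltTm IH.
have [->|[j jT]] := set_0Vmem T; first by rewrite cards0 expr0 mul1r setU0.
have defT : T = j |: T :\ j by rewrite setD1K.
have cT : #|T| = #|T :\ j|.+1 by rewrite (cardsD1 j) jT.
have defST : S :|: T = j |: (S :|: T :\ j) by rewrite setUCA -defT.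
have sST : S :|: T :\ j \subset S :|: T by rewrite defST subsetUr.
have le_U : (1 - x) ^+ #|T :\ j| * #|avoiding A S|%:R
              <= #|avoiding A (S :|: T :\ j)|%:R :> R.
  apply: IHm; first by rewrite -ltnS -cT.
  by move=> U i ltU; apply: IH; apply: leq_trans ltU (subset_leq_card sST).
rewrite cT exprS -mulrA.
apply: (le_trans (ler_wpM2l _ le_U)); first by rewrite subr_ge0.
have [jS|jS] := boolP (j \in S :|: T :\ j).
  have -> : S :|: T = S :|: T :\ j by rewrite defST; apply/setUidPr; rewrite sub1set.
  by rewrite ler_piMl // gerBl.
rewrite defST avoidingU1.
have := cardsID (A j) (avoiding A (S :|: T :\ j)).
have := IH (S :|: T :\ j) j; rewrite defST cardsU1 jS => /(_ (leqnn _)) + eC.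
rewrite -eC natrD [A j :&: _]setIC; lra.
Qed.

(** Conditional probabilities under the uniform measure are written as inequalities between
    cardinalities, so no conditioning event has to be shown nonempty. Strong induction on [#|S|]
    bounds the probability of [A i] given [avoiding A S] by [x]. *)
Lemma lopsided_local_lemma (R : realFieldType) (Omega I : finType)
    (A : I -> {set Omega}) (N : I -> {set I}) (D : nat) (p x : R) :
  (0 < #|Omega|)%N -> 0 <= x < 1 -> p <= x * (1 - x) ^+ D ->
  (forall i, (#|N i| <= D)%N) ->
  (forall i (S : {set I}), [disjoint S & N i] ->
     #|A i :&: avoiding A S|%:R <= p * #|avoiding A S|%:R) ->
  exists w, forall i, w \notin A i.
Proof.
move=> Omega0 /andP[x0 x1] px ND indep.
have x01 : 0 <= x <= 1 by rewrite x0 ltW.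
have key (S : {set I}) i : #|A i :&: avoiding A S|%:R <= x * #|avoiding A S|%:R.
  have [m] := ubnP #|S|; elim: m S i => // m IHm S i ltSm.
  have defS : S = S :\: N i :|: S :&: N i by rewrite setUC setID.
  (* Denominator: the at most [D] neighbours of [i] in [S] are put back one by one, and each step
     conditions on a set smaller than [S]. *)
  have leD : (1 - x) ^+ D * #|avoiding A (S :\: N i)|%:R <= #|avoiding A S|%:R.
    rewrite [in leRHS]defS.
    apply: le_trans (@avoiding_card_ge R _ _ A x (S :\: N i) (S :&: N i) _ _).
    - apply: ler_wpM2r => //; apply: ler_wiXn2l.
      + by rewrite subr_ge0 ltW.
      + by rewrite gerBl.
      + exact: leq_trans (subset_leq_card (subsetIr _ _)) (ND i).
    - by rewrite x0 ltW.
    - by move=> U j; rewrite -defS => ltU; apply: IHm; apply: leq_trans ltU _.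
  apply: le_trans (ler_wpM2l x0 leD); rewrite mulrA.
  apply: le_trans (ler_wpM2r (ler0n _ _) px).
  (* Numerator: forgetting the neighbours only enlarges it, and [indep] then applies. *)
  apply: le_trans (indep i (S :\: N i) _); last first.
    by rewrite disjoints_subset setDE subsetIr.
  by rewrite ler_nat subset_leq_card // setIS // avoidingS // subsetDl.
have := @avoiding_card_ge R _ _ A x set0 setT x01 (fun U i _ => key U i).
have -> : avoiding A set0 = setT.
  by apply/setP => w; rewrite in_setT; apply/avoidingP => j; rewrite inE.
rewrite set0U !cardsT => le_all.
have : (0 : R) < #|avoiding A setT|%:R.
  by apply: lt_le_trans le_all; rewrite mulr_gt0 ?exprn_gt0 ?subr_gt0 ?ltr0n.
rewrite ltr0n => /card_gt0P[w /avoidingP aw]; exists w => i; exact: aw.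
Qed.

Definition binomial_tail (R : nzRingType) (q : R) (k s : nat) : R :=
  \sum_(0 <= j < s) 'C(k, j)%:R * q ^+ j * (1 - q) ^+ (k - j).

(** Condition on the first of [k.+1] trials: a success leaves room for fewer than [s] more, a
    failure for fewer than [s.+1]. *)
Lemma binomial_tailS (R : comNzRingType) (q : R) (k s : nat) :
  binomial_tail q k.+1 s.+1
    = q * binomial_tail q k s + (1 - q) * binomial_tail q k s.+1.
Proof.
rewrite /binomial_tail !big_nat_recl // !bin0 !subn0 !expr0 !mul1r exprS.
rewrite mulrDr addrCA; congr (_ + _).
rewrite !mulr_sumr -big_split /=; apply: eq_bigr => j _.
rewrite binS natrD subSS exprS.
(* For [k <= j] the truncated exponents are both 0, but ['C(k, j.+1)] vanishes. *)
have [ltjk|lekj] := ltnP j k; last first.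
  by rewrite (bin_small (m := j.+1)) ?ltnS // !mul0r mulr0 add0r addr0 -!mulrA mulrCA.
have -> : (k - j = (k - j.+1).+1)%N by rewrite subnS prednK // subn_gt0.
rewrite exprS; ring.
Qed.

Lemma binomial_tail_leS (R : realFieldType) (q : R) (k s : nat) :
  0 <= q <= 1 -> binomial_tail q k s <= binomial_tail q k s.+1.
Proof.
move=> /andP[q0 q1]; rewrite /binomial_tail big_nat_recr //= lerDl.
by rewrite !mulr_ge0 ?exprn_ge0 ?subr_ge0.
Qed.

Section Recoloring.
Variables (V : finType) (t : nat).
Implicit Types (c : {ffun V -> 'I_t}) (B : {set {ffun V -> 'I_t}}).

Definition recolor (i : 'I_t) (v : V) c : {ffun V -> 'I_t} :=
  [ffun u => if u == v then i else c u].

(** The old color of [v] together with the recolored map determines [c], which injects [B] into a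
    product with [t] colors. *)
Lemma card_le_recolored (i : 'I_t) (v : V) B :
  {homo recolor i v : c / c \in B} ->
  (#|B| <= t * #|B :&: [set c : {ffun V -> 'I_t} | c v == i]|)%N.
Proof.
move=> Bv; pose h c := (c v, recolor i v c).
have h_inj : injective h.
  move=> c c' [ecv /ffunP ec]; apply/ffunP => u.
  by have := ec u; rewrite !ffunE; case: eqP => // ->.
rewrite -(card_imset _ h_inj) -[t in (t * _)%N]card_ord -cardsT -cardsX.
apply/subset_leq_card/subsetP => _ /imsetP[c cB ->].
by rewrite !inE Bv //= ffunE !eqxx.
Qed.

(* A Harris-type correlation inequality: the few-vertices event is decreasing in
   the color class of [i] on [L], and the closure hypothesis is all that is used
   of [B] being increasing. *)
Lemma few_colored_card_le (R : realFieldType) (i : 'I_t) (L : seq V) (s : nat) B :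
  uniq L -> {in L, forall v, {homo recolor i v : c / c \in B}} ->
  #|[set c : {ffun V -> 'I_t} | (count (fun v => c v == i) L < s)%N] :&: B|%:R
    <= binomial_tail (1 / t%:R) (size L) s * #|B|%:R :> R.
Proof.
have t0 : (0 < t)%N by apply: leq_trans (ltn_ord i).
have q01 : 0 <= (1 / t%:R : R) <= 1.
  by rewrite divr_ge0 //= ler_pdivrMr ?ltr0n // mul1r ler1n.
elim: L s B => [|v L IHL] [|s] B.
- by move=> _ _; rewrite /binomial_tail big_geq // mul0r
    (_ : _ :&: _ = set0) ?cards0 //; apply/setP => c; rewrite !inE.
- move=> _ _; rewrite /binomial_tail big_nat_recl //= big1 ?addr0 => [|j _].
    by rewrite bin0 !expr0 !mul1r ler_nat subset_leq_card // subsetIr.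
  by rewrite bin0n !mul0r.
- by move=> _ _; rewrite /binomial_tail big_geq // mul0r
    (_ : _ :&: _ = set0) ?cards0 //; apply/setP => c; rewrite !inE ltn0.
move=> /= /andP[vL uL] BL.
set E := [set c : {ffun V -> 'I_t} | c v == i].
(* Since [v] is not in [L], splitting [B] by whether [v] has color [i] keeps both halves closed
   under recoloring in [L]. *)
have E_L u c : u \in L -> (recolor i u c \in E) = (c \in E).
  by move=> uinL; rewrite !inE ffunE ifN //; apply: contraNneq vL => ->.
have BL' u c : u \in L -> c \in B -> recolor i u c \in B.
  by move=> uinL; apply: BL; rewrite in_cons uinL orbT.
pose few r := [set c : {ffun V -> 'I_t} | (count (fun w => c w == i) L < r)%N].
have le1 : #|few s :&: (B :&: E)|%:R
             <= binomial_tail (1 / t%:R) (size L) s * #|B :&: E|%:R :> R.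
  apply: IHL => // u uinL c /setIP[cB cE].
  by rewrite in_setI BL' // E_L.
have le2 : #|few s.+1 :&: (B :\: E)|%:R
             <= binomial_tail (1 / t%:R) (size L) s.+1 * #|B :\: E|%:R :> R.
  apply: IHL => // u uinL c /setDP[cB cE].
  by rewrite in_setD BL' // E_L // cE.
have eB : #|B|%:R = #|B :&: E|%:R + #|B :\: E|%:R :> R by rewrite -natrD cardsID.
have leE : 1 / t%:R * #|B|%:R <= #|B :&: E|%:R :> R.
  rewrite mulrAC mul1r ler_pdivrMr ?ltr0n // -natrM ler_nat mulnC.
  by apply: card_le_recolored; apply: BL; rewrite mem_head.
have leP := binomial_tail_leS (size L) s q01.
set few_v := (X in X :&: B); rewrite -(cardsID E) natrD.
have -> : few_v :&: B :&: E = few s :&: (B :&: E).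
  by apply/setP => c; rewrite !inE; case: (c v == i); rewrite ?andbF ?andbT.
have -> : few_v :&: B :\: E = few s.+1 :&: (B :\: E).
  by apply/setP => c; rewrite !inE; case: (c v == i); rewrite ?andbF ?andbT.
apply: le_trans (lerD le1 le2) _; rewrite binomial_tailS.
move: leE leP; rewrite eB.
set q := 1 / _; set P0 := binomial_tail q _ s; set P1 := binomial_tail q _ _.
move: #|B :&: E|%:R #|B :\: E|%:R => b1 b2 leE leP.
(* This product is exactly the right side minus the left side of the goal. *)
have : 0 <= (P1 - P0) * (b1 - q * (b1 + b2)) by rewrite mulr_ge0 // subr_ge0.
lra.
Qed.

End Recoloring.

(** With [x = 1 / (D + 1)], [(1 - x) ^+ D] is the inverse of [(1 + 1 / D) ^+ D], which is at most e
    because [1 + 1 / D <= expR (1 / D)]. *)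
Lemma lll_threshold (R : realType) (p : R) (D : nat) :
  (0 < D)%N -> expR 1 * p * (D%:R + 1) <= 1 ->
  p <= (D%:R + 1)^-1 * (1 - (D%:R + 1)^-1) ^+ D.
Proof.
move=> D0 epD; set x := (D%:R + 1)^-1.
have Dpos : 0 < D%:R :> R by rewrite ltr0n.
have D1pos : 0 < D%:R + 1 :> R by rewrite ltr_wpDl.
have x1 : 1 - x = (1 + D%:R^-1)^-1 by rewrite /x; field; rewrite !gt_eqF //; lra.
have y0 : 0 < 1 + D%:R^-1 :> R by rewrite ltr_wpDr // invr_ge0 ltW.
have le_e : (1 + D%:R^-1) ^+ D <= expR 1 :> R.
  rewrite -[X in expR X](@mulfV R D%:R) ?gt_eqF // expRM_natl.
  by rewrite lerXn2r ?nnegrE ?expR_ge0 ?(ltW y0) // expR_ge1Dx.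
rewrite x1 exprVn.
apply: (@le_trans _ _ (x / expR 1)).
  by rewrite ler_pdivlMr ?expR_gt0 // /x -[leRHS]mul1r ler_pdivlMr // [p * _]mulrC.
by rewrite ler_pM2l ?invr_gt0 // lef_pV2 ?posrE ?expR_gt0 ?exprn_gt0.
Qed.

Theorem theorem5 (R : realType) (V : finType) (H : hypergraph V)
    (k d t s : nat)
    (edge_size : forall f : {set V}, f \in H -> (k <= #|f|)%N)
    (edge_degree : forall f : {set V}, f \in H -> (#|met_edges H f| <= d)%N)
    (t_ge2 : (2 <= t)%N) (s_ge1 : (1 <= s)%N) (k_ge : (s * t <= k)%N)
    (lll_condition :
      expR (1 : R)
        * (\sum_(0 <= j < s)
             'C(k, j)%:R * (1 / t%:R) ^+ j * (1 - 1 / t%:R) ^+ (k - j))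
        * ((d%:R + 1) * (t%:R - 1) + 1) <= 1) :
  exists c : V -> 'I_t, ts_coloring H s c.
Proof.
have t1 : t%:R - 1 = t.-1%:R :> R.
  by rewrite -[t in t%:R](ltn_predK t_ge2) -natr1 addrK.
pose Edge := {f : {set V} | f \in H}.
pose core (f : Edge) := take k (enum (val f)).
have core_sub f v : v \in core f -> v \in val f.
  by move=> /mem_take; rewrite mem_enum.
pose A (e : Edge * 'I_t) : {set {ffun V -> 'I_t}} :=
  [set c : {ffun V -> 'I_t} | (count (fun v => c v == e.2) (core e.1) < s)%N].
pose N (e : Edge * 'I_t) : {set Edge * 'I_t} :=
  [set e' | (e'.2 != e.2)
         && ((val e'.1 == val e.1) || meets (val e.1) (val e'.1))].
pose D := (d.+1 * t.-1)%N.
have D0 : (0 < D)%N by rewrite muln_gt0 -subn1 subn_gt0.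
have DE : D%:R = (d%:R + 1) * (t%:R - 1) :> R by rewrite natrM -natr1 t1.
pose x : R := (D%:R + 1)^-1.
have x01 : 0 <= x < 1.
  by rewrite invr_ge0 addr_ge0 //= invf_lt1 ?ltrDr ?ltr0n ?unitfE ?ltr_wpDl //.
have px : binomial_tail (1 / t%:R) k s <= x * (1 - x) ^+ D.
  by apply: lll_threshold => //; rewrite DE.
have ND e : (#|N e| <= D)%N.
  case: e => f i.
  pose h (e : Edge * 'I_t) := (val e.1, e.2).
  have h_inj : injective h by move=> [g j] [g' j'] [/val_inj-> ->].
  rewrite -(card_imset _ h_inj).
  (* At most [d + 1] edges, namely [f] and those meeting it, times [t - 1] colors. *)
  apply: (@leq_trans #|setX (val f |: met_edges H (val f)) [set~ i]|).
    apply/subset_leq_card/subsetP => _ /imsetP[[g j] + ->].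
    rewrite !inE /= => /andP[-> fg]; rewrite andbT (valP g) /=.
    by case: eqP fg.
  rewrite cardsX cardsC1 card_ord leq_mul2r cardsU1 -add1n; apply/orP; right.
  by rewrite leq_add ?leq_b1 ?edge_degree ?(valP f).
have indep e (S : {set Edge * 'I_t}) : [disjoint S & N e] ->
    #|A e :&: avoiding A S|%:R
      <= binomial_tail (1 / t%:R) k s * #|avoiding A S|%:R :> R.
  case: e => f i dSN.
  have size_core : size (core f) = k.
    by rewrite size_takel // -cardE edge_size // (valP f).
  rewrite -[k in binomial_tail _ k]size_core; apply: few_colored_card_le.
    by rewrite take_uniq // enum_uniq.
  move=> v vf c /avoidingP aS; apply/avoidingP => -[g j] gS.
  have := aS _ gS; rewrite !inE /= -!leqNgt => /leq_trans; apply.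
  (* Outside [N (f, i)] there are two cases: if [j = i], recoloring [v] cannot lower the count;
     otherwise [g] is disjoint from [f], so [v] is not in [core g]. *)
  have := disjointFr dSN gS; rewrite inE /=.
  have [-> _|_ /= /norP[_ gf]] := eqVneq j i.
    by apply: sub_count => u /=; rewrite ffunE; case: (u == v).
  rewrite leq_eqVlt; apply/orP; left; apply/eqP/eq_in_count => u ug.
  rewrite ffunE ifN //; apply: contraNneq gf => uv; apply/set0Pn; exists v.
  by rewrite inE (core_sub f) // -uv (core_sub g).
have Omega0 : (0 < #|{: {ffun V -> 'I_t}}|)%N.
  by apply/card_gt0P; exists [ffun=> Ordinal (ltnW t_ge2)].
have [c cA] := lopsided_local_lemma Omega0 x01 px ND indep.
exists c => f i fH; have := cA (exist _ f fH, i).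
rewrite inE /= -leqNgt => /leq_trans; apply.
rewrite -size_filter cardE uniq_leq_size ?filter_uniq ?take_uniq ?enum_uniq //.
by move=> v; rewrite mem_filter mem_enum inE => /andP[-> /core_sub ->].
Qed.
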